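(* Let $k\ge 1$ and $n$ be integers with $n > k\,2^{k+1}$. Then \[ \alpha[J_{\pm}(n,k,-1)] = \binom{n}{k}. \]
   Context: For integers $n\ge k\ge 1$ and $t$, $J_{\pm}(n,k,t)$ denotes the graph whose vertex set consists of all vectors in $\{-1,0,1\}^n$ with exactly $k$ nonzero coordinates, two vertices being joined by an edge if and only if their scalar product (standard inner product in $\mathbb{R}^n$) equals $t$. The independence number $\alpha[G]$ of a graph $G$ is the maximum size of an independent set, i.e. a set of vertices no two of which are joined by an edge. *)

(* Defs.v *)
(* MathComp. *)
From HB Require Import structures.
From mathcomp Require Import all_boot all_order all_algebra.

Set Implicit Arguments.
Unset Strict Implicit.
Unset Printing Implicit Defensive.

Import GRing.Theory.
Local Open Scope ring_scope.

Record sgraph := SGraph {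
  svertex :> finType;
  sedge : rel svertex;
  sedge_sym : symmetric sedge;
  sedge_irr : irreflexive sedge }.

Definition independent (G : sgraph) (S : {set G}) : bool :=
  [forall x in S, forall y in S, ~~ sedge x y].

Definition independence_number (G : sgraph) : nat :=
  \max_(S : {set G} | independent S) #|S|.

(* Vectors in {-1, 0, 1}^n; [seq_sub s] is the finite type of the elements of
   the list [s], here of type [int]. *)
Definition signvec (n : nat) : finType :=
  {ffun 'I_n -> seq_sub [:: -1; 0; 1 : int]}.

Definition coordinate n (x : signvec n) (i : 'I_n) : int := ssval (x i).

Definition scalar_product n (x y : signvec n) : int :=
  \sum_(i < n) coordinate x i * coordinate y i.

Definition Jpm_vertex (n k : nat) : finType :=
  {x : signvec n | #|[set i | coordinate x i != 0]| == k}.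

(* The condition [x != y] only matters for t = k: otherwise no vertex has
   scalar product t with itself. *)
Definition Jpm_edge n k (t : int) : rel (Jpm_vertex n k) :=
  fun x y => (x != y) && (scalar_product (val x) (val y) == t).

Lemma Jpm_edge_sym n k t : symmetric (@Jpm_edge n k t).
Proof.
move=> x y; rewrite /Jpm_edge eq_sym /scalar_product; congr (_ && (_ == _)).
by apply: eq_bigr => i _; rewrite mulrC.
Qed.

Lemma Jpm_edge_irr n k t : irreflexive (@Jpm_edge n k t).
Proof. by move=> x; rewrite /Jpm_edge eqxx. Qed.

Definition Jpm (n k : nat) (t : int) : sgraph :=
  SGraph (@Jpm_edge_sym n k t) (@Jpm_edge_irr n k t).

(* Main.v *)
(* Upper bound: take blocks of size k in
   {1, ..., n}, pairwise meeting in at most one point, with q >= 2^k blocks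
   through each point of a block.  If vectors of the independent family with
   support T carry both signs at a point i, then no other block through i
   supports a vector, since such a vector would have product -1 with one of
   them.  When this happens at s points of T, T supports at most 2^s vectors,
   while s (q - 1) blocks support none, each of these being counted at most k
   times; as (2^s - 1) / s is nondecreasing in s <= k, the family has on average
   at most one vector per block.  Averaging over all permutations of the
   coordinates gives the bound 'C(n, k), which is attained by the nonnegative
   vectors. *)

Require Import Defs.
From mathcomp Require Import all_boot all_order all_algebra.
From mathcomp Require Import fingroup perm finfield zify ring.

Set Implicit Arguments.
Unset Strict Implicit.
Unset Printing Implicit Defensive.

Import GRing.Theory.

(** * Growth of powers of two, and permutations acting on subsets *)

Lemma mul_pred_expn2_le s k : s <= k -> k * (2 ^ s).-1 <= s * (2 ^ k).-1.
Proof.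
elim: k => [|k IHk]; first by rewrite leqn0 => /eqP->.
rewrite leq_eqVlt => /predU1P[-> //|]; rewrite ltnS => le_sk.
have [->|s_gt0] := posnP s; first by rewrite muln0.
(* Beyond the induction hypothesis, what remains is [2 ^ s - 1 <= s * 2 ^ k]. *)
have := IHk le_sk; have := leq_pexp2l (isT : 0 < 2) le_sk.
have := expn_gt0 2 s; have := expn_gt0 2 k; rewrite expnS /=.
by move: (2 ^ s) (2 ^ k) => a b; nia.
Qed.

(** Induction on [#|A :\: B|]: transposing a point of [A :\: B] with one of [B :\: A] lowers it by
    one. *)
Lemma perm_imset_transitive (T : finType) (A B : {set T}) :
  #|A| = #|B| -> exists s : {perm T}, s @: A = B.
Proof.
move: {2}#|A :\: B| (erefl #|A :\: B|) => m.
elim: m A => [|m IHm] A cardD cardAB.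
  exists 1%g; have AB : A \subset B by rewrite -setD_eq0 -cards_eq0 cardD.
  have -> : perm_one T @: A = A.
    by rewrite -[RHS]imset_id; apply: eq_imset => x; rewrite perm1.
  by apply/eqP; rewrite eqEcard AB cardAB leqnn.
have /card_gt0P[a aD] : 0 < #|A :\: B| by rewrite cardD.
have /card_gt0P[b bD] : 0 < #|B :\: A|.
  have := cardsID B A; have := cardsID A B; rewrite setIC cardD cardAB; lia.
move: (aD) (bD); rewrite !inE => /andP[aNB aA] /andP[bNA bB].
have tA x : (x \in tperm a b @: A) = (tperm a b x \in A).
  by rewrite -{1}[x](tpermK a b) (mem_imset _ _ perm_inj).
have [||s sA] := IHm (tperm a b @: A); last 1 first.
- exists (tperm a b * s)%g; rewrite -[RHS]sA -imset_comp.
  by apply: eq_imset => x; rewrite permM.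
- have -> : tperm a b @: A :\: B = (A :\: B) :\ a.
    apply/setP=> x; rewrite !inE tA; case: tpermP => [->|->|/eqP xa /eqP xb].
    + by rewrite eqxx (negPf bNA) andbF.
    + by rewrite bB /= andbF.
    + by rewrite xa.
  by apply/eqP; rewrite -eqSS -cardD (cardsD1 a (A :\: B)) aD.
- by rewrite card_imset //; exact: perm_inj.
Qed.

(* By transitivity, the permutations split evenly according to the image of A. *)
Lemma card_perm_imset_eq (T : finType) (k : nat) (A B : {set T}) :
  #|A| = k -> #|B| = k ->
  #|[set s : {perm T} | s @: A == B]| * 'C(#|T|, k) = #|{perm T}|.
Proof.
move=> cardA cardB.
have same (C : {set T}) : #|C| = k ->
    #|[set s : {perm T} | s @: A == C]| = #|[set s : {perm T} | s @: A == B]|.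
  move=> cardC; have [u uC] : exists u : {perm T}, u @: C = B.
    by apply: perm_imset_transitive; rewrite cardB.
  (* Right multiplication by [u] carries the permutations sending [A] to [C] onto those sending [A]
     to [B]. *)
  rewrite -(card_imset _ (mulIg u)); congr #|pred_of_set _|; apply/setP=> s.
  rewrite inE; apply/imsetP/eqP => [[r]|sA].
    rewrite inE => /eqP rA ->; rewrite -uC -rA -imset_comp.
    by apply: eq_imset => x; rewrite permM.
  exists (s * u^-1)%g; last by rewrite mulgKV.
  rewrite inE; apply/eqP; apply: (imset_inj (@perm_inj _ u)).
  by rewrite uC -sA -imset_comp; apply: eq_imset => x; rewrite /= permM permKV.
rewrite mulnC -card_draws -sum_nat_const -[#|{perm T}|]sum1_card.
rewrite (partition_big (fun s : {perm T} => s @: A)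
           (mem [set C : {set T} | #|C| == k])) /=.
  apply: eq_bigr => C; rewrite inE => /eqP/same <-.
  by rewrite sum1_card; apply: eq_card => s; rewrite !inE.
by move=> s _; rewrite inE card_imset ?cardA //; exact: perm_inj.
Qed.

(** * Vectors with a prescribed support *)

Definition support n (x : signvec n) : {set 'I_n} :=
  [set i | coordinate x i != 0%R].

Lemma coordinate_cases n (x : signvec n) i :
  [\/ coordinate x i = (-1)%R, coordinate x i = 0%R | coordinate x i = 1%R].
Proof.
have := ssvalP (x i); rewrite -/(coordinate x i) !inE => /or3P[] /eqP ->.
- exact: Or31.
- exact: Or32.
- exact: Or33.
Qed.

Lemma signvec_eqP n (x y : signvec n) : coordinate x =1 coordinate y -> x = y.
Proof. by move=> xy; apply/ffunP=> i; apply/val_inj/xy. Qed.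

Lemma scalar_product_opposite n (x z : signvec n) i :
  support x :&: support z \subset [set i] -> i \in support x ->
  i \in support z -> coordinate x i != coordinate z i ->
  scalar_product x z = (-1)%R.
Proof.
move=> xz; rewrite !inE => x0 z0 xNz.
rewrite /scalar_product (bigD1 i) //= big1 => [|j ji].
  by move: x0 z0 xNz; case: (coordinate_cases x i) => ->;
     case: (coordinate_cases z i) => ->.
apply/eqP; rewrite mulf_eq0; apply: contraR ji; rewrite negb_or => xz0.
by have := subsetP xz j; rewrite !inE; apply.
Qed.

Definition fiber n (S : {set signvec n}) (A : {set 'I_n}) : {set signvec n} :=
  [set x in S | support x == A].

(** Vectors of the fiber do not vanish on [A], so differing at a point of [A] means having opposite
    signs there. *)
Definition mixed n (S : {set signvec n}) (A : {set 'I_n}) : {set 'I_n} :=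
  [set i in A | [exists x in fiber S A, exists y in fiber S A,
                   coordinate x i != coordinate y i]].

Lemma mixed_sub n (S : {set signvec n}) (A : {set 'I_n}) : mixed S A \subset A.
Proof. by apply/subsetP=> i; rewrite inE => /andP[]. Qed.

Lemma fiber_coordinate n (S : {set signvec n}) (A : {set 'I_n}) x i :
  x \in fiber S A -> (coordinate x i == 0%R) = (i \notin A).
Proof. by rewrite !inE => /andP[_ /eqP <-]; rewrite inE negbK. Qed.

(** A vector of the fiber is determined by the mixed points where it is 1: elsewhere in [A] the
    whole fiber agrees, and outside [A] it vanishes. *)
Lemma card_fiber_le n (S : {set signvec n}) (A : {set 'I_n}) :
  #|fiber S A| <= 2 ^ #|mixed S A|.
Proof.
pose f (x : signvec n) := [set i in mixed S A | coordinate x i == 1%R].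
rewrite -card_powerset -(@card_in_imset _ _ f); last first.
  move=> x y Fx Fy /setP fxy; apply: signvec_eqP => i.
  have [mi|] := boolP (i \in mixed S A).
    have iA := subsetP (mixed_sub S A) i mi.
    have := fxy i; rewrite [LHS]in_set [RHS]in_set mi /=.
    move: (fiber_coordinate i Fx) (fiber_coordinate i Fy); rewrite iA.
    by case: (coordinate_cases x i) => ->; case: (coordinate_cases y i) => ->.
  rewrite inE negb_and; have [iA|iNA _] := boolP (i \in A) => /=.
    by move=> /exists_inPn/(_ x Fx)/exists_inPn/(_ y Fy); rewrite negbK => /eqP.
  have := fiber_coordinate i Fx; have := fiber_coordinate i Fy.
  by rewrite iNA => /eqP-> /eqP->.
apply/subset_leq_card/subsetP=> _ /imsetP[x _ ->].
by rewrite inE; apply/subsetP=> i; rewrite inE => /andP[].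
Qed.

Lemma fiber_blocked n (S : {set signvec n}) (A B : {set 'I_n}) i :
  {in S &, forall x y, x != y -> scalar_product x y != (-1)%R} ->
  #|A :&: B| <= 1 -> i \in mixed S A -> i \in B -> fiber S B = set0.
Proof.
move=> indS AB1; rewrite inE => /andP[iA /exists_inP[x Fx /exists_inP[y Fy xy]]] iB.
have AB : A :&: B \subset [set i].
  have /eqP <- // : [set i] == A :&: B.
  by rewrite eqEcard sub1set inE iA iB cards1.
apply/setP=> z; rewrite in_set0; apply/negP=> Fz.
have opp w : w \in fiber S A -> coordinate w i = coordinate z i.
  move=> Fw; apply/eqP/negPn/negP=> wz; move: Fw Fz.
  rewrite !inE => /andP[wS /eqP wA] /andP[zS /eqP zB].
  have wNz : w != z by apply: contraNneq wz => ->.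
  have /eqP[] := indS w z wS zS wNz.
  by apply: (@scalar_product_opposite _ _ _ i); rewrite ?wA ?zB.
by rewrite !opp ?eqxx in xy.
Qed.

Lemma sum_card_fiber_le n k (D : finType) (B : D -> {set 'I_n})
    (S : {set signvec n}) :
  0 < k ->
  {in S &, forall x y, x != y -> scalar_product x y != (-1)%R} ->
  (forall d, #|B d| = k) ->
  {in predT &, forall d e, d != e -> #|B d :&: B e| <= 1} ->
  (forall d i, i \in B d -> 2 ^ k <= #|[set e | i \in B e]|) ->
  \sum_d #|fiber S (B d)| <= #|D|.
Proof.
move=> k_gt0 indS cardB meetB degB.
pose s d := #|mixed S (B d)|; pose unused d : bool := fiber S (B d) == set0.
have blocked d e i : d != e -> i \in mixed S (B d) -> i \in B e -> unused e.
  by move=> de mi ie; apply/eqP/(fiber_blocked indS _ mi ie)/meetB.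
have mixed_used d i : i \in mixed S (B d) -> ~~ unused d.
  by rewrite inE => /andP[_ /exists_inP[x Fx _]]; apply/set0Pn; exists x.
(* Double count the triples (d, i, e) with i mixed for d and e another block
   through i: such an e is unused, and d is determined by i and e. *)
have count : \sum_d s d * (2 ^ k).-1 <= \sum_(e | unused e) k.
  pose P d i e := [&& d != e, i \in mixed S (B d) & i \in B e].
  apply: (@leq_trans (\sum_d \sum_i \sum_e (P d i e : nat))).
    apply: leq_sum => d _; rewrite -sum_nat_const big_mkcond.
    apply: leq_sum => i _; case: ifP => // mi.
    have id := subsetP (mixed_sub _ _) _ mi.
    have := degB _ _ id.
    rewrite (cardsD1 d) inE id -leq_subLR subn1 => /leq_trans; apply.
    rewrite -sum1_card big_mkcond; apply: leq_sum => e _.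
    by rewrite !inE /P mi eq_sym; case: (_ && _).
  rewrite exchange_big /=; under eq_bigr do rewrite exchange_big /=.
  rewrite exchange_big [leqRHS]big_mkcond /=; apply: leq_sum => e _.
  have [ue|nue] := ifP; last first.
    rewrite big1 // => i _; rewrite big1 // => d _; apply/eqP; rewrite eqb0.
    by apply/negP => /and3P[de mi /(blocked _ _ _ de mi)]; rewrite nue.
  rewrite -(cardB e) -sum1_card [leqRHS]big_mkcond; apply: leq_sum => i _.
  have [/existsP[d Pd]|/existsPn noP] := boolP [exists d, P d i e]; last first.
    by rewrite big1 // => d _; rewrite (negPf (noP d)).
  rewrite (bigD1 d) //= Pd big1 => [|d' d'd]; first by case/and3P: Pd => _ _ ->.
  (* If [i] were mixed for both [d] and [d'], then [d'] would block [d], which is used. *)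
  apply/eqP; rewrite eqb0; apply: contraL Pd => /and3P[_ md' _].
  apply/negP => /and3P[_ md _].
  have id := subsetP (mixed_sub _ _) _ md.
  by have := blocked _ _ _ d'd md' id; apply/negP; exact: mixed_used md.
rewrite -(leq_pmul2l k_gt0) big_distrr /=.
apply: (@leq_trans (\sum_d (k * ~~ unused d + s d * (2 ^ k).-1))).
  apply: leq_sum => d _; have [|used] := boolP (unused d).
    by move=> /eqP ->; rewrite cards0 muln0.
  have sk : s d <= k by rewrite -(cardB d) subset_leq_card ?mixed_sub.
  have := mul_pred_expn2_le sk; have := card_fiber_le S (B d).
  rewrite -/(s d) muln1; have := expn_gt0 2 (s d).
  by move: (2 ^ s d) (s d * _) #|_| => a b c /=; nia.
rewrite big_split /=; apply: leq_trans (leq_add (leqnn _) count) _.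
rewrite [X in _ + X]big_mkcond -big_split /= mulnC -sum_nat_const.
by apply: leq_sum => d _; case: ifP; rewrite (muln0, muln1) ?addn0.
Qed.

(* The blocks are the graphs of the affine functions on the field F with 2^k
   elements, restricted to k abscissas; for k = 1 several indices give the same
   block, which is why blocks are an indexed family and not a set of sets. *)
Lemma exists_affine_blocks n k :
  0 < k -> k * 2 ^ k <= n ->
  exists (D : finType) (B : D -> {set 'I_n}),
    [/\ 0 < #|D|, forall d, #|B d| = k,
        {in predT &, forall d e, d != e -> #|B d :&: B e| <= 1} &
        forall d i, i \in B d -> 2 ^ k <= #|[set e | i \in B e]| ].
Proof.
move=> k_gt0 kn; have [F _ cardF] := pPrimePowerField (isT : prime 2) k_gt0.
have kF : k <= #|F| by rewrite cardF ltnW // ltn_expl.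
pose al (j : 'I_k) : F := enum_val (widen_ord kF j).
have al_inj : injective al by move=> i j /enum_val_inj/(congr1 val) /= /val_inj.
have cardX : #|{: 'I_k * F}| <= n by rewrite card_prod card_ord cardF.
pose f (p : 'I_k * F) : 'I_n := widen_ord cardX (enum_rank p).
have f_inj : injective f.
  by move=> p q /(congr1 val) /= /val_inj/enum_rank_inj.
pose pt (d : F * F) (j : 'I_k) := f (j, d.1 + d.2 * al j)%R.
have pt_inj d : injective (pt d) by move=> i j /f_inj[].
have memB d j v : (f (j, v) \in pt d @: setT) = (v == d.1 + d.2 * al j)%R.
  apply/imsetP/eqP => [[j' _ /f_inj[-> ->]] //|->]; by exists j.
exists (F * F)%type, (fun d => pt d @: setT); split.
- by apply/card_gt0P; exists (0, 0)%R.
- by move=> d; rewrite card_imset // cardsT card_ord.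
- move=> [a b] [a' b'] _ _ de; apply/card_le1_eqP => u v.
  rewrite !inE => /andP[/imsetP[i _ ->] ui] /andP[/imsetP[j _ ->] vj].
  move: ui vj; rewrite /pt !memB /= => /eqP ui /eqP vj.
  have [-> //|ij] := eqVneq i j; case/negP: de; apply/eqP.
  have bb : b = b'.
    (* Two lines agreeing at two distinct abscissas have the same slope, hence the same
       intercept. *)
    have : ((b - b') * (al i - al j) =
            (a + b * al i) - (a' + b' * al i) -
            ((a + b * al j) - (a' + b' * al j)))%R by ring.
    rewrite ui vj !subrr.
    move/eqP; rewrite mulf_eq0 !subr_eq0 (inj_eq al_inj) (negPf ij) orbF.
    by move/eqP.
  by move: ui; rewrite bb => /addIr ->.
- move=> d _ /imsetP[j _ ->]; rewrite -cardF.
  (* For each slope [b], this intercept makes the line pass through the given point. *)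
  pose g b : F * F := (d.1 + d.2 * al j - b * al j, b)%R.
  have g_inj : injective g by move=> b b' [].
  rewrite -cardsT -(card_imset _ g_inj); apply/subset_leq_card/subsetP.
  by move=> _ /imsetP[b _ ->]; rewrite inE /pt memB /= subrK.
Qed.

(** * Averaging over permutations of the coordinates *)

Lemma card_le_bin n k (S : {set signvec n}) :
  0 < k -> k * 2 ^ k <= n ->
  {in S, forall x, #|support x| = k} ->
  {in S &, forall x y, x != y -> scalar_product x y != (-1)%R} ->
  #|S| <= 'C(n, k).
Proof.
move=> k_gt0 kn cardS indS.
have [D [B [D_gt0 cardB meetB degB]]] := exists_affine_blocks k_gt0 kn.
pose N := #|{perm 'I_n}|; have N_gt0 : 0 < N by apply/card_gt0P; exists 1%g.
have total : \sum_(s : {perm 'I_n}) \sum_d #|fiber S (s @: B d)| <= N * #|D|.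
  rewrite -sum_nat_const; apply: leq_sum => s _.
  apply: (sum_card_fiber_le k_gt0 indS) => [d|d e _ _ de|d _ /imsetP[i id ->]].
  - by rewrite card_imset //; exact: perm_inj.
  - rewrite -imsetI; last by move=> ? ? _ _; exact: perm_inj.
    by rewrite card_imset; [exact: meetB | exact: perm_inj].
  - apply: leq_trans (degB d i id) _; apply: eq_leq; apply: eq_card => e.
    by rewrite !inE (mem_imset _ _ perm_inj).
(* Each vector of [S] is counted once for every permutation taking [B d] to its support, a
   proportion [1 / 'C(n, k)] of them all. *)
have count d : (\sum_(s : {perm 'I_n}) #|fiber S (s @: B d)|) * 'C(n, k) = #|S| * N.
  under eq_bigr => s _ do rewrite -sum1dep_card big_mkcondr /=.
  rewrite exchange_big big_distrl /= -sum_nat_const; apply: eq_bigr => x xS.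
  rewrite -[in 'C(_, _)](card_ord n) /N -(card_perm_imset_eq (cardB d) (cardS x xS)).
  congr (_ * _); rewrite -sum1dep_card [RHS]big_mkcond.
  by apply: eq_bigr => s _; rewrite eq_sym.
have : #|S| * (#|D| * N) <= 'C(n, k) * (#|D| * N).
  rewrite [#|D| * N]mulnC [leqRHS]mulnC; apply: leq_trans (leq_mul total (leqnn _)).
  rewrite exchange_big big_distrl /= (eq_bigr _ (fun d _ => count d)) sum_nat_const.
  by rewrite mulnA mulnC.
by rewrite leq_pmul2r // muln_gt0 D_gt0.
Qed.

(** * Nonnegative vectors and the equality *)

Definition indicator n (A : {set 'I_n}) : signvec n :=
  [ffun i => if i \in A then SeqSub (isT : 1%R \in [:: -1; 0; 1 : int]%R)
             else SeqSub (isT : 0%R \in [:: -1; 0; 1 : int]%R)].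

Lemma coordinate_indicator n (A : {set 'I_n}) i :
  coordinate (indicator A) i = ((i \in A)%:R)%R.
Proof. by rewrite /coordinate ffunE; case: ifP. Qed.

Lemma support_indicator n (A : {set 'I_n}) : support (indicator A) = A.
Proof. by apply/setP=> i; rewrite inE coordinate_indicator; case: (i \in A). Qed.

Theorem theorem7 (n k : nat) (hk : (1 <= k)%N) (hn : (k * 2 ^ k.+1 < n)%N) :
  independence_number (Jpm n k (-1)%R) = 'C(n, k).
Proof.
apply/eqP; rewrite eqn_leq; apply/andP; split.
  apply/bigmax_leqP => S /forall_inP indS.
  rewrite -(card_imset _ (@val_inj _ _ (Jpm_vertex n k))).
  apply: card_le_bin => //.
  - by rewrite (leq_trans _ (ltnW hn)) // leq_mul2l leq_exp2l ?leqnSn ?orbT.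
  - by move=> _ /imsetP[x _ ->]; apply/eqP/(valP x).
  - move=> _ _ /imsetP[x xS ->] /imsetP[y yS ->] xy.
    have /forall_inP/(_ y yS) := indS x xS; rewrite /= /Jpm_edge.
    by rewrite (inj_eq val_inj) in xy; rewrite xy.
pose S : {set Jpm n k (-1)%R} :=
  [set x | [forall i, coordinate (val x) i >= 0]%R].
have indS : independent S.
  apply/forall_inP => x; rewrite inE => /forallP x0.
  apply/forall_inP => y; rewrite inE => /forallP y0.
  rewrite /= /Jpm_edge negb_and; apply/orP; right; apply/eqP => xy.
  have : (0 <= scalar_product (val x) (val y))%R.
    by apply: Num.Theory.sumr_ge0 => i _; apply: Num.Theory.mulr_ge0.
  by rewrite xy.
apply: leq_trans (leq_bigmax_cond _ indS).
rewrite -[n in 'C(n, _)]card_ord -card_draws.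
(* Taking supports maps [S] onto the [k]-subsets, with the indicator vectors as preimages. *)
apply: leq_trans (leq_imset_card (fun x : Jpm_vertex n k => support (val x)) (mem S)).
apply/subset_leq_card/subsetP => A; rewrite inE => cardA.
have cA : #|[set i | coordinate (indicator A) i != 0%R]| == k.
  by rewrite -/(support _) support_indicator.
apply/imsetP; exists (Sub (indicator A) cA); last by rewrite /= support_indicator.
by rewrite inE; apply/forallP => i; rewrite /= coordinate_indicator Num.Theory.ler0n.
Qed.
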